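(* Suppose the game of forecasting bounded variables lasts a fixed number $N\ge 1$ of rounds. If all $a_n$ and $b_n$, $n=1,\ldots,N$, are given in advance and $t>0$ is a known constant, then the upper probability of the event $$\frac1N\sum_{n=1}^N(x_n-\mu_n)\ge t$$ does not exceed $$e^{-2N^2t^2/C},$$ where $C:=\sum_{n=1}^N(b_n-a_n)^2$.
   Context: Game of forecasting bounded variables (with $N$ rounds). There are three players, Sceptic, Forecaster and Reality, and it is a perfect-information game: each player sees all earlier moves of the other players before making a move. Protocol: Sceptic announces $\mathcal{K}_0\in\mathbb{R}$. Then, on each round $n=1,\dots,N$, in this order: (1) Forecaster announces an interval $[a_n,b_n]\subseteq\mathbb{R}$ and a number $\mu_n\in(a_n,b_n)$ (so $a_n<b_n$); (2) Sceptic announces $M_n\in\mathbb{R}$; (3) Reality announces $x_n\in[a_n,b_n]$; (4) Sceptic announces a real number $\mathcal{K}_n\le\mathcal{K}_{n-1}+M_n(x_n-\mu_n)$. The number $\mathcal{K}_n$ is called Sceptic's capital after round $n$. That all $a_n$ and $b_n$ are ''given in advance'' means that real numbers $a_n<b_n$, $n=1,\dots,N$, are fixed and known to the players before the game starts, and Forecaster must announce the interval $[a_n,b_n]$ on round $n$; he remains free to choose $\mu_n\in(a_n,b_n)$. All sequences of moves below are those allowed with these fixed intervals. The number $N$ and the constant $t$ are likewise fixed and known before the game starts. A strategy for Sceptic specifies $\mathcal{K}_0$ and, for each $n$, specifies $M_n$ as a function of $(a_1,b_1,\mu_1,x_1,\ldots,a_{n-1},b_{n-1},\mu_{n-1},x_{n-1},a_n,b_n,\mu_n)$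 and $\mathcal{K}_n$ as a function of $(a_1,b_1,\mu_1,x_1,\ldots,a_n,b_n,\mu_n,x_n)$, subject to the constraint in (4) for all possible moves of Forecaster and Reality. A process is a real-valued function defined on all sequences $(a_1,b_1,\mu_1,x_1,\ldots,a_k,b_k,\mu_k,x_k)$, $k=0,1,\ldots,N$, of Forecaster's and Reality's moves allowed in the game (including the empty sequence, $k=0$). For a fixed strategy for Sceptic, his capital $\mathcal{K}_k$, as a function of Forecaster's and Reality's moves, is a process. A (game-theoretic) supermartingale is a process that can be obtained in this way from some strategy for Sceptic. Its initial value is its value $\mathcal{K}_0$ on the empty sequence. It is non-negative if all its values are non-negative. The sample space is the set of all sequences $(a_1,b_1,\mu_1,x_1,\ldots,a_N,b_N,\mu_N,x_N)$ of Forecaster's and Reality's moves in the game. An event is a subset of the sample space. The upper probability of an event $E$ is the infimum of the initial values of non-negative supermartingales that take value at least $1$ on $E$ (i.e., whose value after round $N$ is at least $1$ on every sequence in $E$). *)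

(* Defs.v *)
From HB Require Import structures.
From mathcomp Require Import all_boot all_order all_algebra.
From mathcomp Require Import all_classical all_reals all_analysis.
Import Order.TTheory GRing.Theory Num.Theory.

Set Implicit Arguments.
Unset Strict Implicit.
Unset Printing Implicit Defensive.

Local Open Scope classical_set_scope.
Local Open Scope ring_scope.

Record forecast (R : realType) := Forecast {
  lower : R;
  upper : R;
  mean : R }.

(* The moves of Forecaster and of Reality in one round; the outcome announced
   by Reality is the second component. *)
Definition round (R : realType) : Type := (forecast R * R)%type.

(* The sequences of rounds, of any length k <= N, that can be played when the
   intervals [a_n, b_n] are fixed beforehand.  Rounds are numbered from 0. *)
Definition allowed (R : realType) (N : nat) (a b : 'I_N -> R) :
    set (seq (round R)) :=
  [set h | (size h <= N)%N /\
    forall (n : 'I_N) (f : forecast R) (x : R), onth h n = Some (f, x) ->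
      [/\ lower f = a n, upper f = b n,
          lower f < mean f < upper f & lower f <= x <= upper f]].

Definition sample_space (R : realType) (N : nat) (a b : 'I_N -> R) :
    set (seq (round R)) :=
  [set h | allowed a b h /\ size h = N].

(* Strategies and processes are total functions on sequences of rounds; their
   values on sequences that are not allowed are never used.
   [stake s h f] is M_n, where h lists the n - 1 previous rounds and f is
   Forecaster's move in round n; [later_capital s h] is K_n, where h lists the
   first n >= 1 rounds. *)
Record strategy (R : realType) := Strategy {
  initial_capital : R;
  stake : seq (round R) -> forecast R -> R;
  later_capital : seq (round R) -> R }.

Definition capital (R : realType) (s : strategy R) (h : seq (round R)) : R :=
  if h is [::] then initial_capital s else later_capital s h.

Definition legal (R : realType) (N : nat) (a b : 'I_N -> R)
    (s : strategy R) : Prop :=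
  forall (h : seq (round R)) (f : forecast R) (x : R),
    allowed a b (rcons h (f, x)) ->
    capital s (rcons h (f, x)) <= capital s h + stake s h f * (x - mean f).

Definition supermartingale (R : realType) (N : nat) (a b : 'I_N -> R)
    (V : seq (round R) -> R) : Prop :=
  exists2 s : strategy R, legal a b s &
    forall h, allowed a b h -> V h = capital s h.

Definition nonnegative (R : realType) (N : nat) (a b : 'I_N -> R)
    (V : seq (round R) -> R) : Prop :=
  forall h, allowed a b h -> 0 <= V h.

(* Events are subsets E of the sample space, so the last condition concerns
   only values after round N. *)
Definition upper_probability (R : realType) (N : nat) (a b : 'I_N -> R)
    (E : set (seq (round R))) : \bar R :=
  ereal_inf [set (V [::])%:E | V in
    [set V : seq (round R) -> R |
      [/\ supermartingale a b V, nonnegative a b V &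
          forall h, E h -> 1 <= V h]]].

(* Main.v *)
Require Import Defs.
From mathcomp Require Import all_boot all_order all_algebra.
From mathcomp Require Import all_classical all_reals all_analysis.
From mathcomp Require Import ring lra.
Import Order.TTheory GRing.Theory Num.Theory.

(** The bound is Hoeffding's inequality, with the exponential moment estimate
    replaced by an explicit bet.  For a fixed rate [s >= 0], Sceptic can keep
    his capital after the rounds [h] equal to
      [exp (c + sum over h of (s (x - mu) - s^2 (b - a)^2 / 8))],
    because in each round the growth factor
    [exp (s (x - mu) - s^2 (b - a)^2 / 8)] lies below an affine function of
    the outcome [x] which equals 1 at [x = mu] ([hoeffding_bet]), and such
    affine functions are the factors by which a bet can multiply the capital.
    By convexity the growth factor lies below its chord over [[a, b]];
    Hoeffding's lemma ([hoeffding_two_point]) says that the chord is at most 1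
    at [mu], so that raising it to the value 1 there gives the affine function.

    The intervals being known beforehand, the whole penalty [s^2 C / 8] is
    known too, so it can be prepaid: with [c = s^2 C / 8 - s N t] the final
    capital is [exp (s (sum (x - mu) - N t))], which is at least 1 on the
    event.  The initial capital [exp c] is least for [s = 4 N t / C], where it
    equals [exp (- 2 N^2 t^2 / C)]. *)

Local Open Scope classical_set_scope.
Local Open Scope ring_scope.

(** * Hoeffding's lemma *)

Lemma ge_at0_of_derive_ge0 (R : realType) (f df : R -> R) :
  (forall x : R, 0 <= x -> is_derive x 1 f (df x)) ->
  (forall x : R, 0 <= x -> 0 <= df x) ->
  forall x : R, 0 <= x -> f 0 <= f x.
Proof.
move=> fD df_ge0 x x_ge0.
have [||y] := @MVT_segment R f df 0 x x_ge0.
- by move=> y; rewrite in_itv /= => /andP[/ltW y_ge0 _]; exact: fD.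
- apply: derivable_within_continuous => y.
  by rewrite in_itv /= => /andP[y_ge0 _]; have [] := fD _ y_ge0.
- rewrite in_itv /= => /andP[y_ge0 _]; rewrite -subr_ge0 => ->.
  by rewrite subr0 mulr_ge0 // df_ge0.
Qed.

(** Hoeffding's lemma for a two-point distribution.  The gap
    [p u + u^2 / 8 - ln D] with [D = 1 - p + p e^u] vanishes at [u = 0]
    together with its derivative [p + u / 4 - p e^u / D], written below with
    [p e^u / D = 1 - (1 - p) / D], while its second derivative is
    [1 / 4 - p (1 - p) e^u / D^2], nonnegative because
    [D^2 - 4 p (1 - p) e^u = (1 - p - p e^u)^2]. *)
Lemma hoeffding_two_point (R : realType) (p u : R) : 0 < p < 1 -> 0 <= u ->
  1 - p + p * expR u <= expR (p * u + u ^+ 2 / 8).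
Proof.
move=> /andP[p_gt0 p_lt1] u_ge0.
pose D v := 1 - p + p * expR v.
have D_gt0 v : 0 < D v.
  by rewrite /D addr_gt0 ?subr_gt0 // mulr_gt0 // expR_gt0.
have dD (v : R) : is_derive v 1 D (p * expR v).
  by rewrite /D; apply: is_derive_eq; rewrite add0r mul1r.
have slope_ge0 v : 0 <= v -> 0 <= p + v / 4 - 1 + (1 - p) / D v.
  pose g v := p + v / 4 - 1 + (1 - p) / D v.
  have g0 : g 0 = 0 by rewrite /g /D expR0; field; lra.
  have dg (w : R) : is_derive w 1 g
      (4^-1 - (1 - p) * (p * expR w) / D w ^+ 2).
    have dV := is_deriveV (lt0r_neq0 (D_gt0 w)) (dD w).
    have -> : g = (fun x : R => p - 1) + 4^-1 \*: id
                  + (1 - p) \*: (fun y => (D y)^-1).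
      by apply/funext => y; rewrite /g !fctE /= -![_ *: _]/(_ * _); ring.
    apply: is_derive_eq; rewrite /= -![_ *: _]/(_ * _).
    by field; rewrite ?lt0r_neq0.
  move=> v_ge0; rewrite -[leLHS]g0; move: v v_ge0.
  apply: (ge_at0_of_derive_ge0 _ _ _ (fun w _ => dg w)) => v _.
  rewrite subr_ge0 ler_pdivrMr ?exprn_gt0 // -subr_ge0.
  have -> : 4^-1 * D v ^+ 2 - (1 - p) * (p * expR v)
      = ((1 - p - p * expR v) / 2) ^+ 2 by rewrite /D; field.
  exact: sqr_ge0.
rewrite -[leLHS](lnK (D_gt0 u)) ler_expR -subr_ge0.
pose f v := p * v + v ^+ 2 / 8 - ln (D v).
have f0 : f 0 = 0 by rewrite /f /D expR0 mulr1 subrK ln1; field.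
rewrite -[leLHS]f0; move: u u_ge0.
apply: (@ge_at0_of_derive_ge0 R f (fun v => p + v / 4 - 1 + (1 - p) / D v))
  => v v_ge0; last exact: slope_ge0.
have dln := @is_derive1_comp R (@ln R) D v _ _ (is_derive1_ln (D_gt0 v)) (dD v).
have -> : f = p \*: @id R + 8^-1 \*: ((@id R : R -> R) ^+ 2) - (@ln R \o D).
  by apply/funext => y; rewrite /f !fctE /= -![_ *: _]/(_ * _); ring.
apply: is_derive_eq; rewrite /= -![_ *: _]/(_ * _).
have Dn0 := lt0r_neq0 (D_gt0 v).
have -> : p * expR v = D v - (1 - p) by rewrite /D; ring.
by field.
Qed.

(** * The bet of one round *)

(** The slope of the chord over [[a, b]] of the growth factor
    [fun x => expR (s * (x - m) - (s * (b - a)) ^+ 2 / 8)]. *)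
Definition hoeffding_stake {R : realType} (s a b m : R) : R :=
  expR (s * (a - m)) * (expR (s * (b - a)) - 1) / (b - a)
  * expR (- ((s * (b - a)) ^+ 2 / 8)).

(** In the coordinates [p = (m - a) / w] and [q = (x - a) / w] with
    [w = b - a], the chord of [fun x => expR (s * (x - m))] is its value at [m],
    which is [expR (s * (a - m)) * (1 - p + p * expR (s * w))] and which
    [hoeffding_two_point] bounds by [expR ((s * w) ^+ 2 / 8)], plus its slope
    times [x - m].  Dividing by that bound gives the statement. *)
Lemma hoeffding_bet (R : realType) (s a b m x : R) :
  0 <= s -> a < m < b -> a <= x <= b ->
  expR (s * (x - m) - (s * (b - a)) ^+ 2 / 8)
    <= 1 + hoeffding_stake s a b m * (x - m).
Proof.
move=> s_ge0 /andP[am mb] /andP[ax xb].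
have w_gt0 : 0 < b - a by lra.
have wn0 := lt0r_neq0 w_gt0.
set w := b - a in w_gt0 wn0 *.
pose p := (m - a) / w; pose q := (x - a) / w.
have p01 : 0 < p < 1.
  by apply/andP; split; rewrite /p ?ltr_pdivrMr ?divr_gt0 ?mul1r // /w; lra.
have [q0 q1] : 0 <= q /\ q <= 1.
  by split; rewrite /q ?divr_ge0 ?ler_pdivrMr ?mul1r /w ?subr_ge0; lra.
(* Convexity in tangent form: the exponential lies above its tangent at
   [s * (x - m)], and the exponents at [a] and [b] average to that point with weights [1 - q] and [q]. *)
have chord : expR (s * (x - m))
    <= expR (s * (a - m)) * (1 - p + p * expR (s * w) + (q - p) * (expR (s * w) - 1)).
  have tangent y : expR (s * (x - m)) * (1 + (y - s * (x - m))) <= expR y.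
    rewrite -[X in _ <= expR X](subrKC (s * (x - m))) expRD.
    by rewrite ler_wpM2l ?expR_ge0 // expR_ge1Dx.
  have q'_ge0 : 0 <= 1 - q by lra.
  have := lerD (ler_wpM2l q'_ge0 (tangent (s * (a - m))))
               (ler_wpM2l q0 (tangent (s * (a - m) + s * w))).
  have mixE z : (1 - q) * (z * (1 + (s * (a - m) - s * (x - m))))
      + q * (z * (1 + (s * (a - m) + s * w - s * (x - m)))) = z.
    have xE : x = a + q * w by rewrite /q; field.
    by rewrite xE; ring.
  rewrite mixE => /le_trans; apply; rewrite expRD.
  by rewrite [leRHS](_ : _ = (1 - q) * expR (s * (a - m))
    + q * (expR (s * (a - m)) * expR (s * w))) //; ring.
have two_point : expR (s * (a - m)) * (1 - p + p * expR (s * w))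
    <= expR ((s * w) ^+ 2 / 8).
  have -> : (s * w) ^+ 2 / 8 = s * (a - m) + (p * (s * w) + (s * w) ^+ 2 / 8).
    by rewrite /p; field.
  rewrite [leRHS]expRD ler_wpM2l ?expR_ge0 // hoeffding_two_point //.
  by rewrite mulr_ge0 // ltW.
have qpE : q - p = (x - m) / w by rewrite /q /p; field.
have affine : expR (s * (x - m)) <= expR ((s * w) ^+ 2 / 8)
    + expR (s * (a - m)) * (expR (s * w) - 1) / w * (x - m).
  apply: (le_trans chord); rewrite mulrDr lerD // qpE.
  by rewrite [leLHS](_ : _ = expR (s * (a - m)) * (expR (s * w) - 1) / w
    * (x - m)) //; field.
rewrite expRD -ler_pdivlMr ?expR_gt0 // -expRN opprK.
rewrite /hoeffding_stake -/w mulrDl mul1r.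
suff <- : expR (s * (a - m)) * (expR (s * w) - 1) / w * (x - m)
    = expR (s * (a - m)) * (expR (s * w) - 1) / w
      * expR (- ((s * w) ^+ 2 / 8)) * (x - m) * expR ((s * w) ^+ 2 / 8) by [].
rewrite -[LHS]mulr1 -[X in _ * X = _](expRxMexpNx_1 ((s * w) ^+ 2 / 8)); ring.
Qed.

(** * The exponential supermartingale *)

Definition hoeffding_exponent {R : realType} (s : R) (r : round R) : R :=
  s * (r.2 - mean r.1) - (s * (upper r.1 - lower r.1)) ^+ 2 / 8.

Definition hoeffding_wealth {R : realType} (s c : R) (h : seq (round R)) : R :=
  expR (c + \sum_(r <- h) hoeffding_exponent s r).

Lemma allowed_last (R : realType) (N : nat) (a b : 'I_N -> R)
    (h : seq (round R)) (f : forecast R) (x : R) :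
  allowed a b (rcons h (f, x)) ->
  lower f < mean f < upper f /\ lower f <= x <= upper f.
Proof.
move=> [size_h /(_ (Ordinal (_ : size h < N)%N)) allowed_h].
have hN : (size h < N)%N by rewrite size_rcons in size_h.
have [|_ _ mf xf //] := allowed_h hN f x.
by rewrite /= -cats1 onth_cat ltnn subnn.
Qed.

(** Sceptic stakes the [hoeffding_stake] in proportion to his current capital,
    so [hoeffding_bet] multiplied by that capital is the rule of the game. *)
Lemma hoeffding_wealth_supermartingale (R : realType) (N : nat)
    (a b : 'I_N -> R) (s c : R) :
  0 <= s -> supermartingale a b (hoeffding_wealth s c).
Proof.
move=> s_ge0.
pose S := Strategy (hoeffding_wealth s c [::])
  (fun h f => hoeffding_wealth s c h
              * hoeffding_stake s (lower f) (upper f) (mean f))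
  (hoeffding_wealth s c).
have capitalE h : capital S h = hoeffding_wealth s c h by case: h.
exists S => // h f x /(allowed_last _ _ _ _ _ _ _)[mf xf].
rewrite !capitalE /= /hoeffding_wealth -[rcons _ _]cats1 big_cat big_seq1 /=.
rewrite addrA [leLHS]expRD -mulrA -[X in _ <= X + _]mulr1 -mulrDr.
by rewrite ler_wpM2l ?expR_ge0 // hoeffding_bet.
Qed.

(** Over a complete play the total penalty depends on the prescribed intervals
    alone; this is what lets the initial capital be chosen beforehand. *)
Lemma sum_width (R : realType) (N : nat) (a b : 'I_N -> R)
    (h : seq (round R)) : sample_space a b h ->
  \sum_(r <- h) (upper r.1 - lower r.1) ^+ 2 = \sum_(n < N) (b n - a n) ^+ 2.
Proof.
move=> [[_ allowed_h] size_h]; pose r0 : round R := (Forecast 0 0 0, 0).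
rewrite (big_nth r0) size_h big_mkord; apply: eq_bigr => n _.
have : onth h n by rewrite onthTE size_h.
case hn : (onth h n) => [[f x]|//] _; have [la ub _ _] := allowed_h _ _ _ hn.
by rewrite (onth_nth r0 _ _ _ hn) /= la ub.
Qed.

Lemma upper_probability_le (R : realType) (N : nat) (a b : 'I_N -> R)
    (E : set (seq (round R))) (V : seq (round R) -> R) :
  supermartingale a b V -> nonnegative a b V -> (forall h, E h -> 1 <= V h) ->
  (upper_probability a b E <= (V [::])%:E)%E.
Proof. by move=> sV V0 V1; apply: ereal_inf_lbound; exists V. Qed.

Theorem corollary1 (R : realType) (N : nat) (hN : (1 <= N)%N)
    (a b : 'I_N -> R) (hab : forall n : 'I_N, a n < b n)
    (t : R) (ht : 0 < t) :
  let C : R := \sum_(n < N) (b n - a n) ^+ 2 in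
  let E : set (seq (round R)) := sample_space a b `&`
    [set h : seq (round R) | t <= N%:R^-1 * \sum_(r <- h) (r.2 - mean r.1)] in
  (upper_probability a b E <= (expR (- (2 * N%:R ^+ 2 * t ^+ 2) / C))%:E)%E.
Proof.
cbv zeta; set C : R := \sum_(n < N) _; set E := _ `&` _.
have N_gt0 : 0 < N%:R :> R by rewrite ltr0n.
have C_gt0 : 0 < C.
  rewrite /C (bigD1 (Ordinal hN)) //= ltr_pwDl ?exprn_gt0 ?subr_gt0 //.
  by apply: sumr_ge0 => n _; exact: sqr_ge0.
(* This rate minimizes [s ^+ 2 * C / 8 - s * (N%:R * t)]. *)
pose s := 4 * N%:R * t / C.
have s_ge0 : 0 <= s by rewrite /s divr_ge0 ?mulr_ge0 // ltW.
pose c := s ^+ 2 * C / 8 - s * (N%:R * t).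
have -> : expR (- (2 * N%:R ^+ 2 * t ^+ 2) / C) = hoeffding_wealth s c [::].
  by rewrite /hoeffding_wealth big_nil /c /s; congr expR; field; rewrite lt0r_neq0.
apply: upper_probability_le.
- exact: hoeffding_wealth_supermartingale.
- by move=> h _; exact: expR_ge0.
move=> h [h_full /=]; rewrite mulrC ler_pdivlMr // => t_le.
rewrite /hoeffding_wealth -expR0 ler_expR.
have -> : \sum_(r <- h) hoeffding_exponent s r
    = s * \sum_(r <- h) (r.2 - mean r.1) - s ^+ 2 * C / 8.
  rewrite /C -(sum_width _ _ _ _ _ h_full) sumrB -mulr_sumr; congr (_ - _).
  rewrite mulr_sumr mulr_suml; apply: eq_bigr => r _.
  by rewrite exprMn.
have -> : c + (s * \sum_(r <- h) (r.2 - mean r.1) - s ^+ 2 * C / 8)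
    = s * (\sum_(r <- h) (r.2 - mean r.1) - t * N%:R) by rewrite /c; ring.
by rewrite mulr_ge0 // subr_ge0.
Qed.
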